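(* Let $(x_t)_{t\ge 0}$ be the iterates of the Stochastic Frank-Wolfe (SFW) method (defined in the context) for the problem $\min_{x\in C}F(x)$, and let $x^*\in\arg\min_{x\in C}F(x)$. Suppose that: (1) $\|x-y\|\le D$ for all $x,y\in C$; (2) $F$ is convex and $\|\nabla F(x)-\nabla F(y)\|\le L\|x-y\|$ for all $x,y\in C$; (3) the stochastic gradients are unbiased, $\mathbb{E}_{z\sim P}[\nabla\tilde F(x,z)]=\nabla F(x)$, and $\mathbb{E}_{z\sim P}\big[\|\nabla\tilde F(x,z)-\nabla F(x)\|^2\big]\le\sigma^2$ for all $x\in C$. If $\gamma_t=2/(t+8)$ and $\rho_t=4/(t+8)^{2/3}$, then for all $t\ge 0$ $$\mathbb{E}\big[F(x_t)-F(x^* )\big]\le\frac{Q}{(t+9)^{1/3}},$$ where $$Q:=\max\left\{9^{1/3}\big(F(x_0)-F(x^* )\big),\ \frac{LD^2}{2}+2D\max\left\{2\|\nabla F(x_0)-d_0\|,\ \big(16\sigma^2+2L^2D^2\big)^{1/2}\right\}\right\}.$$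
   Context: Setting: $C\subset\mathbb{R}^n$ is a nonempty compact convex set, $z$ is a random variable with distribution $P$, $\tilde F(x,z)$ is a stochastic function, and $F(x)=\mathbb{E}_{z\sim P}[\tilde F(x,z)]$. Only $F$ (not $\tilde F(\cdot,z)$) is assumed convex and smooth. $\|\cdot\|$ is the Euclidean norm. SFW method: given deterministic stepsizes $\rho_t>0$, $\gamma_t>0$, a deterministic starting point $x_0\in C$ and $d_0=0\in\mathbb{R}^n$, and i.i.d. samples $z_1,z_2,\dots\sim P$, the iterates are defined by $$d_t=(1-\rho_t)d_{t-1}+\rho_t\nabla\tilde F(x_t,z_t)\quad(t\ge1),$$ $$v_t\in\arg\min_{v\in C}d_t^Tv,\qquad x_{t+1}=(1-\gamma_{t+1})x_t+\gamma_{t+1}v_t\quad(t\ge0).$$ (Since $d_0=0$, $v_0$ is an arbitrary fixed point of $C$; minimizers $v_t$ are chosen measurably.) The expectation is over all the samples. *)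

(* Defs.v *)
From HB Require Import structures.
From mathcomp Require Import all_boot all_order all_algebra.
From mathcomp Require Import all_classical all_reals all_analysis.

Set Implicit Arguments.
Unset Strict Implicit.
Unset Printing Implicit Defensive.

Import Order.TTheory GRing.Theory Num.Theory.
Import numFieldNormedType.Exports.

Local Open Scope classical_set_scope.
Local Open Scope ring_scope.

Definition dotr (R : realType) (n : nat) (u v : 'rV[R]_n) : R :=
  \sum_(i < n) u ord0 i * v ord0 i.

(* The library norm `|u| on 'rV[R]_n is the sup norm, with the same topology. *)
Definition enorm (R : realType) (n : nat) (u : 'rV[R]_n) : R :=
  Num.sqrt (dotr u u).

(* The gradient as the row of partial derivatives; it is only used at points
   where f is (Frechet) differentiable. *)
Definition gradient (R : realType) (n : nat) (f : 'rV[R]_n -> R)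
    (x : 'rV[R]_n) : 'rV[R]_n :=
  \row_(i < n) 'D_(delta_mx ord0 i) (f : 'rV[R]_n -> R^o) x.

Definition argmin (R : realType) (T : Type) (C : set T) (f : T -> R) : set T :=
  [set x | C x /\ forall y, C y -> f x <= f y].

(* R^n equipped with its Borel sigma-algebra. *)
Definition borel_rV (R : realType) (n : nat) :=
  g_sigma_algebraType (@open 'rV[R]_n).

(* X_1, X_2, ... are mutually independent with common distribution P. Samples
   are numbered from 1: X 0 is unconstrained and never used. *)
Definition iid_samples (R : realType) (d d' : measure_display)
    (Omega : measurableType d) (Z : measurableType d')
    (Pr : probability Omega R) (P : probability Z R)
    (X : nat -> {RV Pr >-> Z}) : Prop :=
  (forall t, (0 < t)%N ->
     forall B : set Z, measurable B -> distribution Pr (X t) B = P B) /\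
  (forall (J : seq nat) (B : nat -> set Z),
     uniq J -> (forall j, j \in J -> (0 < j)%N) ->
     (forall j, j \in J -> measurable (B j)) ->
     Pr (\bigcap_(j in [set` J]) (X j @^-1` B j)) =
     (\prod_(j <- J) Pr (X j @^-1` B j))%E).

(* sigma(X_1, ..., X_t); it is the trivial sigma-algebra for t = 0. *)
Definition history (Omega : Type) (d' : measure_display)
    (Z : measurableType d') (X : nat -> Omega -> Z) (t : nat) :
    set (set Omega) :=
  <<s \bigcup_(s in [set s | (0 < s <= t)%N])
        preimage_set_system setT (X s) measurable >>.

(* Runs of stochastic Frank-Wolfe driven by the samples X. The choice of a
   minimizer v_t may depend, measurably, on the samples X_1, ..., X_t drawn so
   far and on nothing else; in particular v_0 is deterministic. *)
Record SFW_run (R : realType) (n : nat) (Omega : Type) (d' : measure_display)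
    (Z : measurableType d') (C : set 'rV[R]_n) (Ft : 'rV[R]_n -> Z -> R)
    (X : nat -> Omega -> Z) (rho gamma : nat -> R) (x0 d0 : 'rV[R]_n)
    (x dir v : nat -> Omega -> 'rV[R]_n) : Prop := MkSFWRun {
  SFW_x0 : forall w, x 0%N w = x0 ;
  SFW_d0 : forall w, dir 0%N w = d0 ;
  SFW_dS : forall t w, dir t.+1 w =
    (1 - rho t.+1) *: dir t w
    + rho t.+1 *: gradient (fun y => Ft y (X t.+1 w)) (x t.+1 w) ;
  SFW_v : forall t w, argmin C (dotr (dir t w)) (v t w) ;
  SFW_v_adapted : forall t (B : set (borel_rV R n)),
    measurable B -> history X t (v t @^-1` B) ;
  SFW_xS : forall t w, x t.+1 w =
    (1 - gamma t.+1) *: x t w + gamma t.+1 *: v t w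
}.

(* Main.v *)
Require Import Defs.
From HB Require Import structures.
From mathcomp Require Import all_boot all_order all_algebra.
From mathcomp Require Import all_classical all_reals all_analysis.
From mathcomp Require Import measurable_realfun ring lra.

Set Implicit Arguments.
Unset Strict Implicit.
Unset Printing Implicit Defensive.

Import Order.TTheory GRing.Theory Num.Theory.
Import numFieldNormedType.Exports.

Local Open Scope classical_set_scope.
Local Open Scope ring_scope.

(** Two expectations are followed along the run: the second moment
    phi_t = E |grad F(x_t) - d_t|^2 of the momentum error, and the gap
    a_t = E [F(x_t) - F(xstar)].

    Momentum error. Since x_{t+1} is determined by the first t samples, sample
    t+1 is fresh noise: grad F(x_{t+1}) - d_{t+1} is a part fixed by the past
    minus rho times a centred variable, and the cross term of its square
    integrates to zero (sqnorm_unbiased_le). The part fixed by the past is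
    (1 - rho) times the previous error, displaced by the change of the gradient,
    at most L gamma D (momentum_drift). Hence, with rho and gamma taken at t+1,
      phi_{t+1} <= (1 - rho/2) phi_t + rho^2 sigma^2 + 2 (L gamma D)^2 / rho,
    which is expected_error_step. No conditional expectation is formed: the
    joint law of the past and of the fresh sample is a product measure
    (history_indep, by a pi-lambda argument on cylinders), so Tonelli's theorem
    turns the expectation into an iterated integral whose inner integral is over
    P (ge0_integral_next_sample).

    Gap. The descent lemma, first-order convexity and the optimality of v_t for
    d_t give, surely,
      F(x_{t+1}) - F(xstar) <= (1 - gamma) (F(x_t) - F(xstar))
        + gamma D |grad F(x_t) - d_t| + L D^2 gamma^2 / 2
    (frank_wolfe_step); the first moment of the error is reduced to phi_t by the
    arithmetic-geometric inequality with an optimized weight (amgm_weighted,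
    optimize_weight), so that no square root of an integral appears.

    Rates. With c = (t + 9)^(1/3) one has gamma_{t+1} = 2 / c^3 and
    rho_{t+1} = 4 / c^2, and both recursions close by elementary inequalities
    between c and the cube root of c^3 + 1 (momentum_step, gap_step). Let M be the
    inner maximum in Q. The bound phi_t <= M^2 / c^2 cannot start the first
    induction, because |grad F(x_0) - d_0| is only bounded by M / 2 while 9^(2/3)
    exceeds 4. The bound phi_t <= 2 M^2 / c^2 can, and it gives a first moment
    at most (3/2) M / c, which the second induction absorbs: the factor
    1 - 2 / c^3 of the gap leaves room up to (5/3) M / c. *)

(** * Euclidean geometry *)

Section Euclidean.
Variables (R : realType) (n : nat).
Implicit Types (u v w : 'rV[R]_n) (a b : R).

Lemma dotrC u v : dotr u v = dotr v u.
Proof. by apply: eq_bigr => i _; rewrite mulrC. Qed.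

Lemma dotrDl u v w : dotr (u + v) w = dotr u w + dotr v w.
Proof. by rewrite /dotr -big_split; apply: eq_bigr => i _; rewrite mxE mulrDl. Qed.

Lemma dotrZl a u v : dotr (a *: u) v = a * dotr u v.
Proof. by rewrite /dotr mulr_sumr; apply: eq_bigr => i _; rewrite mxE mulrA. Qed.

Lemma dotrNl u v : dotr (- u) v = - dotr u v.
Proof. by rewrite -scaleN1r dotrZl mulN1r. Qed.

Lemma dotrBl u v w : dotr (u - v) w = dotr u w - dotr v w.
Proof. by rewrite dotrDl dotrNl. Qed.

Lemma dotrDr u v w : dotr u (v + w) = dotr u v + dotr u w.
Proof. by rewrite dotrC dotrDl !(dotrC u). Qed.

Lemma dotrZr a u v : dotr u (a *: v) = a * dotr u v.
Proof. by rewrite dotrC dotrZl dotrC. Qed.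

Lemma dotrBr u v w : dotr u (v - w) = dotr u v - dotr u w.
Proof. by rewrite dotrC dotrBl !(dotrC u). Qed.

Lemma dotr_ge0 u : 0 <= dotr u u.
Proof. by apply: sumr_ge0 => i _; rewrite -expr2 sqr_ge0. Qed.

Lemma enorm_ge0 u : 0 <= enorm u.
Proof. exact: sqrtr_ge0. Qed.

Lemma enorm_sqr u : enorm u ^+ 2 = dotr u u.
Proof. by rewrite sqr_sqrtr ?dotr_ge0. Qed.

Lemma enormZ a u : enorm (a *: u) = `|a| * enorm u.
Proof.
by rewrite /enorm dotrZl dotrZr mulrA -expr2 sqrtrM ?sqr_ge0 // sqrtr_sqr.
Qed.

Lemma enorm0_eq0 u : enorm u = 0 -> u = 0.
Proof.
move=> u0; have /eqP := enorm_sqr u; rewrite u0 expr0n /= eq_sym psumr_eq0.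
  move=> /allP h; apply/rowP => i; rewrite mxE; apply/eqP.
  by have := h i (mem_index_enum i); rewrite mulf_eq0 orbb.
by move=> i _; rewrite -expr2 sqr_ge0.
Qed.

Lemma cauchy_schwarz u v : dotr u v <= enorm u * enorm v.
Proof.
have [/enorm0_eq0 ->|v0] := eqVneq (enorm v) 0.
  rewrite (_ : dotr u 0 = 0) ?mulr_ge0 ?enorm_ge0//.
  by rewrite -(scale0r 0) dotrZr mul0r.
have vp : 0 < enorm v by rewrite lt_def v0 enorm_ge0.
have [/enorm0_eq0 ->|u0] := eqVneq (enorm u) 0.
  rewrite (_ : dotr 0 v = 0) ?mulr_ge0 ?enorm_ge0//.
  by rewrite -(scale0r 0) dotrZl mul0r.
have up : 0 < enorm u by rewrite lt_def u0 enorm_ge0.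
have := dotr_ge0 (enorm v *: u - enorm u *: v).
rewrite !(dotrBl, dotrBr, dotrZl, dotrZr) -!enorm_sqr (dotrC v u) => h.
have {}h : 0 <= (2 * (enorm u * enorm v)) * (enorm u * enorm v - dotr u v).
  by apply: le_trans h _; rewrite le_eqVlt; apply/orP; left; apply/eqP; ring.
by rewrite pmulr_rge0 ?subr_ge0 // in h; rewrite !mulr_gt0.
Qed.

(** The weighted form of the parallelogram bound; the weight is what lets the
    momentum average contract. *)
Lemma enorm_sqrD_le (b : R) u v : 0 < b ->
  enorm (u + v) ^+ 2 <= (1 + b) * enorm u ^+ 2 + (1 + b^-1) * enorm v ^+ 2.
Proof.
move=> b0; rewrite !enorm_sqr !(dotrDl, dotrDr) (dotrC v u).
have := dotr_ge0 (b *: u - v).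
rewrite !(dotrBl, dotrBr, dotrZl, dotrZr) (dotrC v u).
set U := dotr u u; set V := dotr v v; set W := dotr u v => h.
have : 0 <= b^-1 * (b * (b * U) - 2 * (b * W) + V).
  by apply: mulr_ge0; [rewrite invr_ge0 ltW|lra].
have -> : b^-1 * (b * (b * U) - 2 * (b * W) + V) = b * U - 2 * W + b^-1 * V.
  by field; rewrite gt_eqF.
by move=> ?; lra.
Qed.

End Euclidean.

(** * First-order calculus along segments of a convex set *)

Section Calculus.
Variables (R : realType) (n : nat).
Implicit Types (C : set 'rV[R]_n) (F : 'rV[R]_n -> R) (x y h : 'rV[R]_n).

Lemma convex_set_segment C x y (s : R) : convex_set C -> C x -> C y ->
  0 <= s -> s <= 1 -> C ((1 - s) *: x + s *: y).
Proof.
move=> cC Cx Cy s0 s1.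
have := cC y x (Itv01 s0 s1); rewrite !inE => /(_ Cy Cx).
by rewrite /conv /= addrC.
Qed.

(** Differentiability makes the directional derivative linear in the direction,
    so the partial derivatives determine it. *)
Lemma derive_gradient F x h : differentiable (F : 'rV[R]_n -> R^o) x ->
  'D_h (F : 'rV[R]_n -> R^o) x = dotr (gradient F x) h.
Proof.
move=> dF; rewrite deriveE// {1}(row_sum_delta h) linear_sum /dotr.
by apply: eq_bigr => i _; rewrite linearZ /= !mxE -deriveE// mulrC.
Qed.

Lemma is_derive_along F x h (s : R) :
  differentiable (F : 'rV[R]_n -> R^o) (x + s *: h) ->
  is_derive s (1 : R) (fun t : R => (F (x + t *: h) : R^o))
    (dotr (gradient F (x + s *: h)) h).
Proof.
move=> dF; have dv := @diff_derivable _ _ _ _ _ h dF.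
rewrite -(derive_gradient h dF).
have xE (t : R) : x + (t * 1 + s) *: h = t *: h + (x + s *: h).
  by rewrite mulr1 scalerDl addrCA.
have E : (fun t : R => t^-1 *:
     (((fun t0 : R => (F (x + t0 *: h) : R^o)) \o shift s) (t *: (1 : R))
      - (F (x + s *: h) : R^o)))
   = (fun t : R => t^-1 *: (((F : 'rV[R]_n -> R^o) \o shift (x + s *: h)) (t *: h)
      - (F (x + s *: h) : R^o))).
  by apply/funext => t; congr (_ *: (F _ - _)); exact: xE.
by split; rewrite /derivable /derive E.
Qed.

(** The difference quotients at 0+ in the direction y - x are bounded by
    F y - F x, and their limit is the directional derivative. *)
Lemma convex_first_order C F x y : convex_set C -> convex_function C F ->
  C x -> C y -> differentiable (F : 'rV[R]_n -> R^o) x ->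
  F x + dotr (gradient F x) (y - x) <= F y.
Proof.
move=> cC cF Cx Cy dF; rewrite -lerBrDl -(derive_gradient (y - x) dF).
have dv := @diff_derivable _ _ _ _ _ (y - x) dF.
apply: (@cvgr_to_le _ (0 : R)^'+ _ _
   (fun t : R => t^-1 *: (((F : 'rV[R]_n -> R^o) \o shift x) (t *: (y - x)) - (F x : R^o)))).
  exact: (cvg_dnbhs_at_right dv).
near=> t.
have t0 : 0 < t by near: t; exact: nbhs_right_gt.
have t1 : t <= 1 by near: t; apply: nbhs_right_le.
rewrite /= /GRing.scale /= ler_pdivrMl//.
have := cF (Itv01 (ltW t0) t1) y x; rewrite !inE => /(_ Cy Cx).
move=> H.
have {}H : F (t *: y + (1 - t) *: x) <= t * F y + (1 - t) * F x by exact: H.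
have -> : t *: (y - x) + x = t *: y + (1 - t) *: x.
  by rewrite scalerBr scalerBl scale1r -addrA (addrC (- _)).
by lra.
Unshelve. all: by end_near.
Qed.

(** Integrating the gradient along the segment, in the form of a
    monotonicity argument: the defect of the quadratic model has a nonpositive
    derivative. *)
Lemma descent_lemma C F (L : R) x y : convex_set C ->
  (forall z, C z -> differentiable (F : 'rV[R]_n -> R^o) z) ->
  (forall z w, C z -> C w ->
     enorm (gradient F z - gradient F w) <= L * enorm (z - w)) ->
  C x -> C y ->
  F y <= F x + dotr (gradient F x) (y - x) + L / 2 * enorm (y - x) ^+ 2.
Proof.
move=> cC dF LF Cx Cy.
set h := y - x; set a := dotr (gradient F x) h; set k := L / 2 * enorm h ^+ 2.
have Cseg (s : R) : 0 <= s -> s <= 1 -> C (x + s *: h).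
  move=> s0 s1; have := convex_set_segment cC Cx Cy s0 s1.
  by rewrite /h scalerBr scalerBl scale1r -addrA (addrC (- _)).
pose psi : R -> R^o := fun t : R =>
  F (x + t *: h) - (t * a + k * (t * t)).
have dpsi (s : R) : 0 <= s -> s <= 1 -> is_derive s (1 : R) psi
    (dotr (gradient F (x + s *: h)) h - (a + k * (2 * s))).
  move=> s0 s1; have dFs := is_derive_along (dF _ (Cseg _ s0 s1)).
  apply: is_derive_eq; rewrite /GRing.scale /=; lra.
have le0 (s : R) : 0 <= s -> s <= 1 ->
    dotr (gradient F (x + s *: h)) h - (a + k * (2 * s)) <= 0.
  move=> s0 s1; rewrite opprD addrA -dotrBl subr_le0.
  apply: le_trans (cauchy_schwarz _ _) _.
  have := LF _ _ (Cseg _ s0 s1) Cx; rewrite [x + _ - x]addrC addKr enormZ ger0_norm// => H.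
  apply: le_trans (ler_wpM2r (enorm_ge0 _) H) _.
  by rewrite /k; lra.
have : psi 1 <= psi 0.
  apply: (@ler0_derive1_nincr _ psi 0 1) => //.
  - by move=> s; rewrite in_itv /= => /andP[/ltW s0 /ltW s1]; have [] := dpsi _ s0 s1.
  - move=> s; rewrite in_itv /= => /andP[/ltW s0 /ltW s1]; rewrite derive1E.
    by have [_ ->] := dpsi _ s0 s1; exact: le0.
  - apply: derivable_within_continuous => s; rewrite in_itv /= => /andP[s0 s1].
    by have [] := dpsi _ s0 s1.
rewrite /psi scale1r scale0r addr0 /h [x + _]addrC subrK; lra.
Qed.

End Calculus.

(** * Measurability of vector-valued maps and of gradients *)

Section BorelVector.
Variables (R : realType) (n : nat) (d : measure_display) (T : measurableType d).

Lemma open_borel_rV (U : set 'rV[R]_n) :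
  open U -> measurable (U : set (borel_rV R n)).
Proof. by move=> oU; apply: sub_sigma_algebra. Qed.

Lemma measurable_coord (f : T -> borel_rV R n) i :
  measurable_fun setT f -> measurable_fun setT (fun w => f w ord0 i).
Proof.
move=> mf; apply: (measurability _ (RGenOpens.measurableE R)).
move=> _ [_ [a [b ->]] <-].
rewrite (_ : _ `&` _ = setT `&` f @^-1` [set u | `]a, b[%classic (u ord0 i)])//.
apply: mf => //; apply: open_borel_rV.
by apply: (open_comp (fun u _ => @coord_continuous R 1 n ord0 i u)); exact: itv_open.
Qed.

(** Every open set of R^n is a countable union of cubes with rational centres
    and radii 1/(k+1), and the preimage of a cube is a finite intersection of
    coordinate conditions. *)
Lemma measurable_rV (f : T -> borel_rV R n) :
  (forall i, measurable_fun setT (fun w => f w ord0 i)) -> measurable_fun setT f.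
Proof.
move=> mf; apply: (measurability (@open 'rV[R]_n : set (set (borel_rV R n))) erefl).
move=> _ [U oU <-]; rewrite setTI.
pose box (q : 'rV[rat]_n) (k : nat) : set 'rV[R]_n :=
  [set u | forall i, `|u ord0 i - ratr (q ord0 i)| < k.+1%:R^-1].
pose I := ('rV[rat]_n * nat)%type.
have -> : f @^-1` U = \bigcup_(p : I)
    [set w | box p.1 p.2 `<=` U /\ box p.1 p.2 (f w)].
  apply/seteqP; split => w /=; last by move=> [p _ [pU]] /pU.
  move=> Ufw; have /nbhs_ballP[e /= e0 eU] : nbhs (f w : 'rV[R]_n) U.
    by apply: open_nbhs_nbhs.
  have [k ke] : exists k : nat, k.+1%:R^-1 < e / 2.
    have [k _ kP] : \forall k \near \oo, k.+1%:R^-1 < e / 2.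
      exact: (near_infty_natSinv_lt (PosNum (divr_gt0 e0 (ltr0n _ 2)))).
    by exists k; exact: (kP k (leqnn k)).
  have kp : 0 < k.+1%:R^-1 :> R by rewrite invr_gt0.
  have qex i : exists q : rat, `|f w ord0 i - ratr q| < k.+1%:R^-1.
    have /rat_in_itvoo[q] : f w ord0 i < f w ord0 i + k.+1%:R^-1 by rewrite ltrDl.
    rewrite in_itv /= => /andP[q1 q2]; exists q.
    by rewrite distrC ger0_norm ?subr_ge0 ?ltrBlDl// ltW.
  have [q qP] := choice qex.
  exists (\row_i q i, k) => //=; split; last by move=> i; rewrite mxE.
  move=> u ubox; apply: eU; split => // i j.
  have -> : i = ord0 by exact: ord1.
  rewrite -ball_normE /=.
  have h1 := qP j; have h2 := ubox j; rewrite mxE in h2.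
  apply: le_lt_trans (ler_distD (ratr (q j)) _ _) _.
  by rewrite (distrC _ (u _ _)) (splitr e) ltrD ?(lt_trans _ ke).
apply: countable_bigcupT_measurable; first exact: countableP.
move=> [q k] /=.
have [qU|nqU] := pselect (box q k `<=` U); last first.
  by rewrite (_ : [set _ | _] = set0)//; apply/seteqP; split => // w [].
have -> : [set w | box q k `<=` U /\ box q k (f w)] = \bigcap_(i in [set: 'I_n])
    [set w | `|f w ord0 i - ratr (q ord0 i)| < k.+1%:R^-1].
  apply/seteqP; split => w /=; first by move=> [_ h] i _; exact: h.
  by move=> h; split => // i; exact: h.
apply: fin_bigcap_measurable; first exact: finite_finset.
move=> i _; rewrite -[X in measurable X]setTI.
have mg : measurable_fun setT (fun w => `|f w ord0 i - ratr (q ord0 i)|).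
  by apply: measurableT_comp => //; apply: measurable_funB => //.
have := mg measurableT `]-oo, k.+1%:R^-1[%classic (measurable_itv _).
by congr (measurable (_ `&` _)); apply/seteqP; split => w /=; rewrite in_itv.
Qed.

Lemma measurable_dotr (f : T -> borel_rV R n) :
  measurable_fun setT f -> measurable_fun setT (fun w => dotr (f w) (f w)).
Proof.
move=> mf; apply: measurable_sum => i.
by apply: measurable_funM; exact: measurable_coord.
Qed.

Lemma measurable_linear_comb (a b : R) (f g : T -> borel_rV R n) :
  measurable_fun setT f -> measurable_fun setT g ->
  measurable_fun setT (fun w => (a *: (f w : 'rV[R]_n) + b *: (g w : 'rV[R]_n)) : borel_rV R n).
Proof.
move=> mf mg; apply: measurable_rV => i.
under eq_fun do rewrite !mxE.
by apply: measurable_funD; apply: measurable_funM => //; exact: measurable_coord.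
Qed.

Lemma measurable_sqdist (f g : T -> borel_rV R n) :
  measurable_fun setT f -> measurable_fun setT g ->
  measurable_fun setT
    (fun w => enorm ((f w : 'rV[R]_n) - (g w : 'rV[R]_n)) ^+ 2).
Proof.
move=> mf mg; under eq_fun do rewrite enorm_sqr.
have := measurable_dotr (measurable_linear_comb 1 (- 1) mf mg).
by under eq_fun do rewrite !scale1r !scaleN1r.
Qed.

(** A partial derivative at a moving point is the pointwise limit of the
    difference quotients with steps 1/(k+1), each of which is measurable as soon as the
    function is jointly measurable. *)
Lemma measurable_gradient dS (S : measurableType dS) (H : 'rV[R]_n -> S -> R)
    (Y : T -> borel_rV R n) (s : T -> S) :
  measurable_fun setT (fun p : (borel_rV R n * S)%type => H p.1 p.2) ->
  measurable_fun setT Y -> measurable_fun setT s ->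
  (forall w, differentiable ((fun y => H y (s w)) : 'rV[R]_n -> R^o) (Y w)) ->
  measurable_fun setT (fun w => gradient (fun y => H y (s w)) (Y w) : borel_rV R n).
Proof.
move=> mH mY ms dH; apply: measurable_rV => i.
under eq_fun do rewrite mxE.
pose e : 'rV[R]_n := delta_mx ord0 i.
have mHY (Y' : T -> borel_rV R n) : measurable_fun setT Y' ->
    measurable_fun setT (fun w => H (Y' w) (s w)).
  by move=> mY'; exact: (measurableT_comp mH (measurable_fun_pair mY' ms)).
pose q (k : nat) (w : T) : R := (k.+1%:R^-1)^-1 *
  (H (k.+1%:R^-1 *: e + (Y w : 'rV[R]_n)) (s w) - H (Y w) (s w)).
apply: (@measurable_fun_cvg _ _ _ setT q).
  move=> k; apply: measurable_funM => //; apply: measurable_funB; last exact: mHY.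
  apply: (mHY (fun w => (k.+1%:R^-1 *: e + (Y w : 'rV[R]_n)) : borel_rV R n)).
  have := @measurable_linear_comb k.+1%:R^-1 1 (cst (e : borel_rV R n)) Y.
  by under [X in _ -> _ -> measurable_fun _ X]eq_fun do rewrite scale1r; apply.
move=> w _.
have dv := @diff_derivable _ _ _ _ _ e (dH w).
apply: (@cvg_comp _ _ _ (fun k : nat => k.+1%:R^-1 : R)
  (fun t : R => t^-1 *: ((((fun y => H y (s w)) : 'rV[R]_n -> R^o)
     \o shift (Y w : 'rV[R]_n)) (t *: e) - (H (Y w) (s w) : R^o))) _ (0 : R)^' _ _ dv).
move=> A /= [r r0 rA].
have [k _ kP] : \forall k \near \oo, k.+1%:R^-1 < r.
  exact: (near_infty_natSinv_lt (PosNum r0)).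
exists k => // m km; apply: rA; last by rewrite invr_eq0 pnatr_eq0.
by rewrite /ball /= sub0r normrN ger0_norm ?invr_ge0//; exact: kP.
Qed.

End BorelVector.

(** * Independence of the next sample from the past *)

Section Freezing.
Context (R : realType) (d d1 d2 : measure_display) (Omega : measurableType d)
  (T1 : measurableType d1) (T2 : measurableType d2).
Variables (Pr : probability Omega R) (Q : probability T2 R).
Variables (phi : Omega -> T1) (psi : Omega -> T2).
Hypotheses (mphi : measurable_fun setT phi) (mpsi : measurable_fun setT psi).
Hypothesis indep : forall A B, measurable A -> measurable B ->
  Pr (phi @^-1` A `&` psi @^-1` B) = (Pr (phi @^-1` A) * Q B)%E.

(** The joint law is the product of the laws, so Tonelli applies. This replaces
    conditioning on phi. *)
Lemma ge0_integral_indep (f : T1 * T2 -> \bar R) :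
  measurable_fun setT f -> (forall p, 0 <= f p)%E ->
  (\int[Pr]_w f (phi w, psi w) = \int[Pr]_w \int[Q]_z f (phi w, z))%E.
Proof.
move=> mf f0.
pose phi_m : {mfun Omega >-> T1} := HB.pack phi (isMeasurableFun.Build _ _ _ _ _ mphi).
have mj : measurable_fun setT (fun w => (phi w, psi w)).
  exact: measurable_fun_pair.
pose j_m : {mfun Omega >-> (T1 * T2)%type} :=
  HB.pack (fun w => (phi w, psi w)) (isMeasurableFun.Build _ _ _ _ _ mj).
transitivity (\int[distribution Pr j_m]_p f p)%E.
  by rewrite ge0_integral_pushforward.
transitivity (\int[distribution Pr phi_m \x Q]_p f p)%E.
  apply: eq_measure_integral => A mA _; apply/esym.
  by apply: product_measure_unique => // A1 A2 mA1 mA2; exact: indep.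
rewrite fubini_tonelli1// ge0_integral_pushforward//.
  exact: measurable_fun_fubini_tonelli_F.
by move=> y _; apply: integral_ge0.
Qed.

End Freezing.

Section History.
Context (R : realType) (d d' : measure_display) (Omega : measurableType d)
  (Z : measurableType d').
Variables (Pr : probability Omega R) (P : probability Z R).
Variable X : nat -> {RV Pr >-> Z}.

(** Omega with the sigma-algebra of the first t samples, so that being adapted
    is ordinary measurability. *)
Definition past (t : nat) : measurableType _ :=
  g_sigma_algebraType (\bigcup_(s in [set s | (0 < s <= t)%N])
    preimage_set_system [set: Omega] (X s) measurable).

Lemma sample_past s t : (0 < s <= t)%N ->
  measurable_fun setT (X s : past t -> Z).
Proof.
move=> st _ B mB; apply: sub_sigma_algebra; exists s => //.
by exists B.
Qed.

Lemma past_sub t (A : set Omega) :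
  measurable (A : set (past t)) -> measurable A.
Proof.
move: A; apply: smallest_sub; first exact: (@sigma_algebra_measurable _ Omega).
by move=> _ [s _] [B mB <-]; exact: (measurable_funP (X s) measurableT _ mB).
Qed.

Lemma past_mono s t (A : set Omega) : (s <= t)%N ->
  measurable (A : set (past s)) -> measurable (A : set (past t)).
Proof.
move=> st; move: A; apply: sub_smallest2r; first exact: smallest_sigma_algebra.
by move=> A [r /= /andP[r0 rs] rA]; exists r => //=; rewrite r0 (leq_trans rs).
Qed.

Lemma measurable_fun_past t dU (U : measurableType dU) (f : Omega -> U) :
  measurable_fun setT (f : past t -> U) -> measurable_fun setT f.
Proof. by move=> mf _ B mB; apply: (@past_sub t); exact: mf. Qed.

Lemma measurable_fun_past_mono s t dU (U : measurableType dU) (f : Omega -> U) :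
  (s <= t)%N -> measurable_fun setT (f : past s -> U) ->
  measurable_fun setT (f : past t -> U).
Proof. by move=> st mf _ B mB; apply: (past_mono st); exact: mf. Qed.

(** Every one of the first t samples is constrained, possibly by the full set,
    so that an intersection of cylinders is formed coordinatewise and
    independence is always used for the same list of indices. *)
Definition cylinder t : set (set Omega) :=
  [set A | exists B : nat -> set Z, (forall j, measurable (B j)) /\
     A = \bigcap_(j in [set` iota 1 t]) (X j @^-1` B j)].

Lemma cylinderI t : setI_closed (cylinder t).
Proof.
move=> _ _ [B [mB ->]] [B' [mB' ->]].
exists (fun j => B j `&` B' j); split; first by move=> j; exact: measurableI.
apply/seteqP; split => w /=; first by move=> [h h'] j jt; split; [exact: h|exact: h'].
by move=> h; split => j jt; have [] := h j jt.
Qed.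

Lemma cylinderT t : cylinder t setT.
Proof.
by exists (fun=> setT); split => //; apply/seteqP; split.
Qed.

Lemma history_cylinder t : history X t `<=` <<s cylinder t >>.
Proof.
apply: sub_smallest2r; first exact: smallest_sigma_algebra.
move=> A [s /= st] [B mB <-].
exists (fun j => if j == s then B else setT); split.
  by move=> j; case: ifP.
rewrite setTI; apply/seteqP; split => w /=.
  by move=> XB j /= _; case: eqP => // ->.
by move=> /(_ s) /=; rewrite mem_iota eqxx add1n ltnS; apply.
Qed.

Hypothesis X_iid : iid_samples P X.

(** Both sides are finite measures in A. They agree on cylinders by mutual
    independence, and the cylinders form a pi-system generating the history. *)
Lemma history_indep t A B : history X t A -> measurable B ->
  Pr (A `&` X t.+1 @^-1` B) = (Pr A * P B)%E.
Proof.
move=> hA mB.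
have mE : measurable (X t.+1 @^-1` B) by exact: measurable_funPTI.
pose r : {nonneg R} := NngNum (fine_ge0 (measure_ge0 P B)).
have rE : r%:num%:E = P B by rewrite /r /= fineK// fin_num_measure.
pose m1 := mrestr Pr mE.
pose m2 := mscale r Pr.
have m2E C : m2 C = (Pr C * P B)%E by rewrite /m2 /mscale /= rE muleC.
suff : m1 A = m2 A by rewrite m2E.
apply: (@g_sigma_algebra_measure_unique _ _ _ (cylinder t) _ (fun=> setT)).
- move=> _ [C [mC ->]]; apply: fin_bigcap_measurable; first exact: finite_seq.
  by move=> j _; exact: measurable_funPTI.
- by move=> _; exact: cylinderT.
- by apply/seteqP; split => // w _; exists 0%N.
- exact: cylinderI.
- move=> _ [C [mC ->]]; apply: (etrans _ (esym (m2E _))).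
  rewrite -[LHS]/(Pr (_ `&` _)).
  pose C' j := if j == t.+1 then B else C j.
  have tn : t.+1 \notin iota 1 t by rewrite mem_iota add1n ltnn andbF.
  have C'E j : j \in iota 1 t -> C' j = C j.
    by move=> jt; rewrite /C'; case: eqP => // jE; rewrite jE (negbTE tn) in jt.
  have C'n : C' t.+1 = B by rewrite /C' eqxx.
  have mC' j : measurable (C' j) by rewrite /C'; case: ifP.
  have := X_iid.2 (t.+1 :: iota 1 t) C'.
  rewrite /= tn iota_uniq => /(_ erefl) H.
  have {}H := H (ltac:(by move=> j; rewrite inE => /predU1P[->//|]; rewrite mem_iota => /andP[]))
    (fun j _ => mC' j).
  have := X_iid.2 (iota 1 t) C (iota_uniq _ _)
    (ltac:(by move=> j; rewrite mem_iota => /andP[])) (fun j _ => mC j).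
  move=> ->.
  rewrite big_cons C'n in H.
  rewrite (X_iid.1 t.+1 (ltn0Sn _) B mB : Pr (X t.+1 @^-1` B) = _) in H.
  rewrite (eq_big_seq (fun j => Pr (X j @^-1` C j))) in H; last first.
    by move=> j jt; rewrite C'E.
  rewrite muleC -H; congr (Pr _); apply/seteqP; split => w /=.
    move=> [h hB] j /=; rewrite inE => /predU1P[->|jt]; first by rewrite C'n.
    by rewrite C'E//; exact: h.
  move=> h; split; last by have := h t.+1; rewrite /= inE eqxx C'n; apply.
  by move=> j jt; rewrite -(C'E _ jt); apply: h; rewrite /= inE jt orbT.
- by move=> _; rewrite /m1 /mrestr; apply: le_lt_trans (probability_le1 _ _) _;
    rewrite ?ltry//; apply: measurableI.
- exact: history_cylinder.
Qed.

Lemma ge0_integral_next_sample t (f : past t * Z -> \bar R) :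
  measurable_fun setT f -> (forall p, 0 <= f p)%E ->
  (\int[Pr]_w f (w, X t.+1 w) = \int[Pr]_w \int[P]_z f (w, z))%E.
Proof.
move=> mf f0.
apply: (@ge0_integral_indep _ _ _ _ _ _ _ Pr P (id : Omega -> past t)) => //.
- by move=> _ A mA; rewrite setTI; exact: (@past_sub t).
- by move=> A B mA mB; exact: history_indep.
Qed.

End History.

(** * Second moments of an unbiased estimate *)

Section Moments.
Context (R : realType) (d : measure_display) (T : measurableType d).
Variable P : probability T R.

(** Expectations of nonnegative functions are propagated as upper bounds in the
    extended reals, so that finiteness is a conclusion of the recursions. *)
Lemma integral_le_affine (f : T -> \bar R) (g h : T -> R) (a b k G H : R) :
  measurable_fun setT f -> measurable_fun setT g -> measurable_fun setT h ->
  (forall w, 0 <= f w)%E -> (forall w, 0 <= g w) -> (forall w, 0 <= h w) ->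
  0 <= a -> 0 <= b -> 0 <= k ->
  (forall w, f w <= (a * g w + b * h w + k)%:E)%E ->
  (\int[P]_w (g w)%:E <= G%:E)%E -> (\int[P]_w (h w)%:E <= H%:E)%E ->
  (\int[P]_w f w <= (a * G + b * H + k)%:E)%E.
Proof.
move=> mf mg mh f0 g0 h0 a0 b0 k0 fle gG hH.
have mg' : measurable_fun setT (EFin \o g) by exact/measurable_EFinP.
have mh' : measurable_fun setT (EFin \o h) by exact/measurable_EFinP.
have mag : measurable_fun setT (fun w => a%:E * (g w)%:E)%E by exact: measurable_funeM.
have mbh : measurable_fun setT (fun w => b%:E * (h w)%:E)%E by exact: measurable_funeM.
apply: (@le_trans _ _
    (\int[P]_w ((a%:E * (g w)%:E + b%:E * (h w)%:E) + k%:E))%E).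
  apply: ge0_le_integral => //.
  by apply: emeasurable_funD => //; exact: emeasurable_funD.
have ag0 w : (0 <= a%:E * (g w)%:E)%E by rewrite mule_ge0 ?lee_fin.
have bh0 w : (0 <= b%:E * (h w)%:E)%E by rewrite mule_ge0 ?lee_fin.
rewrite ge0_integralD//=; last 2 first.
- by move=> w _; rewrite adde_ge0.
- exact: emeasurable_funD.
rewrite ge0_integralD// !ge0_integralZl ?lee_fin//=; last 2 first.
- by move=> w _; rewrite lee_fin.
- by move=> w _; rewrite lee_fin.
rewrite integral_cst//= probability_setT mule1 !EFinD !EFinM.
by apply: leeD => //; apply: leeD; apply: lee_wpmul2l; rewrite ?lee_fin.
Qed.

Variable n : nat.

(** The cross term vanishes because the estimate is unbiased. *)
Lemma sqnorm_unbiased_le (G : T -> borel_rV R n) (g a : 'rV[R]_n) (r s : R) :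
  measurable_fun setT G ->
  (forall i, 'E_P[fun z => G z ord0 i] = (g ord0 i)%:E)%E ->
  ('E_P[fun z => (enorm ((G z : 'rV[R]_n) - g) ^+ 2)%R] <= (s ^+ 2)%:E)%E ->
  (\int[P]_z (enorm (a - r *: ((G z : 'rV[R]_n) - g)) ^+ 2)%:E
     <= (enorm a ^+ 2 + r ^+ 2 * s ^+ 2)%:E)%E.
Proof.
rewrite unlock => mG Gg Gs.
pose D z : 'rV[R]_n := (G z : 'rV[R]_n) - g.
pose q z := enorm (D z) ^+ 2.
have mg : measurable_fun setT (cst (g : borel_rV R n) : T -> borel_rV R n).
  exact: measurable_cst.
have mD i : measurable_fun setT (fun z => D z ord0 i).
  rewrite /D; under eq_fun do rewrite !mxE.
  by apply: measurable_funB => //; exact: measurable_coord.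
have mq : measurable_fun setT q by exact: measurable_sqdist mG mg.
have q0 z : 0 <= q z by rewrite /q sqr_ge0.
have iq : P.-integrable setT (EFin \o q).
  apply/integrableP; split; first exact/measurable_EFinP.
  under eq_integral do rewrite /= ger0_norm//.
  exact: le_lt_trans Gs (ltry _).
have iD i : P.-integrable setT (EFin \o (fun z => D z ord0 i)).
  apply: (@le_integrable _ _ _ _ _ _ _ (EFin \o (fun z => q z + 1))) => //.
  - exact/measurable_EFinP.
  - move=> z _; rewrite /= lee_fin [leRHS]ger0_norm ?addr_ge0//.
    have Dq : D z ord0 i ^+ 2 <= q z.
      rewrite /q enorm_sqr /dotr (bigD1 i)//= expr2 lerDl.
      by apply: sumr_ge0 => j _; rewrite -expr2 sqr_ge0.
    by rewrite ler_norml; apply/andP; split; nra.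
  - apply: (@eq_integrable _ _ _ _ _ _ ((EFin \o q) \+ (EFin \o cst 1%R))%E) => //.
    by apply: integrableD => //; exact: finite_measure_integrable_cst.
have ED i : (\int[P]_z (D z ord0 i)%:E = 0)%E.
  have iG : P.-integrable setT (EFin \o (fun z => G z ord0 i)).
    apply: (@eq_integrable _ _ _ _ _ _
      ((EFin \o (fun z => D z ord0 i)) \+ (EFin \o cst (g ord0 i)))%E) => //.
      by move=> z _; rewrite /= -EFinD /D !mxE subrK.
    by apply: integrableD => //; exact: finite_measure_integrable_cst.
  under eq_integral do rewrite /D !mxE EFinB.
  rewrite integralB_EFin//; last exact: finite_measure_integrable_cst.
  by rewrite Gg integral_cst//= probability_setT mule1 subee.
have iaD : P.-integrable setT (EFin \o (fun z => dotr a (D z))).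
  apply: (@eq_integrable _ _ _ _ _ _
    (fun z => \sum_(i < n) (a ord0 i)%:E * (D z ord0 i)%:E)%E) => //.
    by move=> z _; rewrite /= /dotr -sumEFin.
  apply: integrable_sum => // i _; exact: (integrableZl measurableT (a ord0 i) (iD i)).
have EaD : (\int[P]_z (dotr a (D z))%:E = 0)%E.
  under eq_integral do rewrite /dotr -sumEFin.
  rewrite integral_sum//; last by move=> i; exact: (integrableZl measurableT (a ord0 i) (iD i)).
  apply: big1 => i _; have := integralZl measurableT (iD i) (a ord0 i).
  by rewrite /= ED mule0.
have E z : enorm (a - r *: ((G z : 'rV[R]_n) - g)) ^+ 2
    = enorm a ^+ 2 + (- (2 * r)) * dotr a (D z) + r ^+ 2 * q z.
  rewrite -/(D z) /q; move: (D z) => e.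
  by rewrite !enorm_sqr !(dotrBl, dotrBr, dotrZl, dotrZr) (dotrC e a); ring.
under eq_integral do rewrite E 2!EFinD !EFinM.
have i1 : P.-integrable setT (fun z => (- (2 * r))%:E * (dotr a (D z))%:E)%E.
  exact: integrableZl.
have i2 : P.-integrable setT (fun z => (r ^+ 2)%:E * (q z)%:E)%E.
  exact: integrableZl.
have i0 : P.-integrable setT (EFin \o cst (enorm a ^+ 2)).
  exact: finite_measure_integrable_cst.
rewrite integralD//; last exact: integrableD.
have j1 : (\int[P]_z ((- (2 * r))%:E * (dotr a (D z))%:E) = 0)%E.
  by have := integralZl measurableT iaD (- (2 * r)); rewrite /= EaD mule0.
have j2 := integralZl measurableT iq (r ^+ 2).
rewrite /= in j2.
rewrite integralD// j1 j2 adde0.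
rewrite integral_cst//= probability_setT mule1 EFinD (EFinM (r ^+ 2)).
apply: leeD2l; apply: lee_wpmul2l => //.
by rewrite lee_fin sqr_ge0.
Qed.

End Moments.

(** * Numerical recursions with cube roots *)

Section CubeRoots.
Variable R : realType.
Implicit Types (s c b B K m Q : R).

Lemma cbrtX3 s : 0 <= s -> (s `^ (1 / 3)) ^+ 3 = s.
Proof.
move=> s0; rewrite -powR_mulrn ?powR_ge0// -powRrM.
by rewrite (_ : 1 / 3 * 3%:R = 1) ?powRr1//; field.
Qed.

Lemma powR23 s : s `^ (2 / 3) = (s `^ (1 / 3)) ^+ 2.
Proof.
by rewrite -powR_mulrn ?powR_ge0// -powRrM mulrAC mul1r.
Qed.

Lemma ler_cube b c : 0 <= b -> 0 <= c -> (b ^+ 3 <= c ^+ 3) = (b <= c).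
Proof. by move=> b0 c0; rewrite ler_pXn2r. Qed.

(** Subadditivity of s |-> s^(2/3), between s = c^3 and s + 1 = b^3. *)
Lemma cbrt_succ_sq c b : 0 <= c -> 0 <= b -> b ^+ 3 = c ^+ 3 + 1 ->
  b ^+ 2 <= c ^+ 2 + 1.
Proof.
move=> c0 b0 bc; rewrite -ler_cube ?addr_ge0 ?sqr_ge0//.
rewrite -exprM (exprM b 3 2) bc.
have := sqr_ge0 (c ^+ 2 - c); have := sqr_ge0 c; nra.
Qed.

(** The concave cube root lies below its tangent at s = c^3. *)
Lemma cbrt_succ c b : 0 < c -> 0 <= b -> b ^+ 3 = c ^+ 3 + 1 ->
  b <= c + (3 * c ^+ 2)^-1.
Proof.
move=> c0 b0 bc; set u := _^-1.
have u0 : 0 <= u by rewrite invr_ge0 mulr_ge0// sqr_ge0.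
have uE : 3 * c ^+ 2 * u = 1 by rewrite mulfV// mulf_neq0// expf_neq0// gt_eqF.
rewrite -ler_cube ?addr_ge0 ?(ltW c0)// bc.
have -> : (c + u) ^+ 3 = c ^+ 3 + 3 * c ^+ 2 * u + (3 * c * u ^+ 2 + u ^+ 3) by ring.
rewrite uE lerDl addr_ge0 ?exprn_ge0// mulr_ge0 ?sqr_ge0//.
by rewrite mulr_ge0// ltW.
Qed.

(** With weight rho/2 = 2/c^2 the contraction removes 2B/c^4 while the noise adds
    at most B/c^4; what remains is B(c^2 - 1)/c^4, and b^2 <= c^2 + 1. *)
Lemma momentum_step c b B K : 2 <= c -> 0 < b -> b ^+ 3 = c ^+ 3 + 1 ->
  0 <= B -> K <= B ->
  (1 - 4 / c ^+ 2 / 2) * (B / c ^+ 2) + K / c ^+ 4 <= B / b ^+ 2.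
Proof.
move=> c2 b0 bc B0 KB.
have c0 : 0 < c by lra.
have c20 : 0 < c ^+ 2 by rewrite exprn_gt0.
have b20 : 0 < b ^+ 2 by rewrite exprn_gt0.
have h : b ^+ 2 <= c ^+ 2 + 1 by apply: cbrt_succ_sq; rewrite ?ltW.
apply: (@le_trans _ _ (B * ((c ^+ 2 - 1) / c ^+ 4))).
  have -> : (1 - 4 / c ^+ 2 / 2) * (B / c ^+ 2) = B * ((c ^+ 2 - 2) / c ^+ 4).
    by field; rewrite gt_eqF.
  have -> : B * ((c ^+ 2 - 1) / c ^+ 4) = B * ((c ^+ 2 - 2) / c ^+ 4) + B / c ^+ 4.
    by field; rewrite gt_eqF.
  by rewrite lerD2l ler_wpM2r// invr_ge0 exprn_ge0// ltW.
apply: ler_wpM2l => //.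
rewrite ler_pdivrMr ?exprn_gt0// mulrC ler_pdivlMr//.
apply: (@le_trans _ _ ((c ^+ 2 - 1) * (c ^+ 2 + 1))); last first.
  rewrite (_ : c ^+ 4 = (c ^+ 2) ^+ 2) -?exprM//; nra.
by rewrite ler_wpM2l//; nra.
Qed.

(** Dividing by y/c with y = c^-3, the contraction gains 2Q, and lowering the target
    from Q/c to Q/b costs Q/3; the remaining (5/3)Q exceeds the 3m + K that the
    two error terms cost. *)
Lemma gap_step c b Q m K : 2 <= c -> 0 < b -> b ^+ 3 = c ^+ 3 + 1 ->
  0 <= m -> 0 <= K -> K + 2 * m <= Q ->
  (1 - 2 / c ^+ 3) * (Q / c) + 2 / c ^+ 3 * (3 / 2 * m / c) + K * (2 / c ^+ 3) ^+ 2
    <= Q / b.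
Proof.
move=> c2 b0 bc m0 K0 KQ.
have c0 : 0 < c by lra.
have Q0 : 0 <= Q by lra.
have := cbrt_succ c0 (ltW b0) bc; set u := _^-1 => bu.
have u0 : 0 <= u by rewrite invr_ge0 mulr_ge0// sqr_ge0.
have uE : u = 3^-1 * (c ^+ 2)^-1 by rewrite /u invfM.
pose y : R := (c ^+ 3)^-1.
have y0 : 0 < y by rewrite invr_gt0 exprn_gt0.
(* since b <= c (1 + y/3) and (1 - y/3) (1 + y/3) <= 1 *)
have hb : (1 - y / 3) / c <= b^-1.
  rewrite ler_pdivrMr// [leRHS]mulrC ler_pdivlMr//.
  have [y3|y3] := leP (y / 3) 1; last by nra.
  apply: (@le_trans _ _ ((1 - y / 3) * (c + u))); first by rewrite ler_wpM2l ?subr_ge0.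
  have -> : u = c * (y / 3).
    by rewrite uE /y; field; rewrite gt_eqF.
  by have := sqr_ge0 (y / 3); nra.
apply: (@le_trans _ _ (Q * ((1 - y / 3) / c))); last by rewrite ler_wpM2l.
have yc : c * y <= 1 / 4.
  have -> : c * y = (c ^+ 2)^-1 by rewrite /y; field; rewrite gt_eqF.
  by rewrite div1r lef_pV2 ?posrE ?exprn_gt0//; nra.
have -> : (1 - 2 / c ^+ 3) * (Q / c) + 2 / c ^+ 3 * (3 / 2 * m / c)
     + K * (2 / c ^+ 3) ^+ 2
   = (Q + y * (3 * m - 2 * Q + 4 * K * (c * y))) / c.
  by rewrite /y; field; rewrite gt_eqF.
rewrite [leRHS]mulrA ler_wpM2r ?invr_ge0 ?(ltW c0)//.
have : 4 * K * (c * y) <= K by nra.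
nra.
Qed.

End CubeRoots.

(** * One step of the method *)

Section Objective.
Context (R : realType) (n : nat) (d : measure_display) (Z : measurableType d).
Variables (P : probability Z R) (Ft : 'rV[R]_n -> Z -> R) (F : 'rV[R]_n -> R).
Hypothesis Ft_measurable :
  measurable_fun setT (fun p : (borel_rV R n * Z)%type => Ft p.1 p.2).
Hypothesis F_def : forall x, (F x)%:E = ('E_P[Ft x])%E.

(** F is an integral with a parameter: Tonelli's theorem applies to the positive
    and negative parts of the integrand. *)
Lemma measurable_objective : measurable_fun setT (F : borel_rV R n -> R).
Proof.
apply/measurable_EFinP.
have -> : EFin \o F = (fun x => \int[P]_z ((fun z => (Ft x z)%:E)^\+ z)
                          - \int[P]_z ((fun z => (Ft x z)%:E)^\- z))%E.
  by apply/funext => x; rewrite /= F_def unlock integralE.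
have mFt : measurable_fun setT
    (fun p : (borel_rV R n * Z)%type => (Ft p.1 p.2)%:E).
  exact/measurable_EFinP.
apply: emeasurable_funB.
- have h := @measurable_fun_fubini_tonelli_F _ _ _ _ _ P _
    (measurable_funepos mFt) (funepos_ge0 _).
  apply: eq_measurable_fun h => x _; rewrite /fubini_F.
  by apply: eq_integral => z _; rewrite !funeposE.
- have h := @measurable_fun_fubini_tonelli_F _ _ _ _ _ P _
    (measurable_funeneg mFt) (funeneg_ge0 _).
  apply: eq_measurable_fun h => x _; rewrite /fubini_F.
  by apply: eq_integral => z _; rewrite !funenegE.
Qed.

End Objective.

Section Geometry.
Context (R : realType) (n : nat) (C : set 'rV[R]_n) (F : 'rV[R]_n -> R).
Variables (D L : R).
Hypotheses (C_convex : convex_set C) (F_convex : convex_function C F)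
  (F_differentiable : forall x, C x -> differentiable (F : 'rV[R]_n -> R^o) x)
  (diam_C : forall x y, C x -> C y -> enorm (x - y) <= D)
  (F_smooth : forall x y, C x -> C y ->
      enorm (gradient F x - gradient F y) <= L * enorm (x - y))
  (L0 : 0 <= L).

Lemma momentum_coef (r q e : R) : 0 < r -> r <= 1 -> 0 <= q -> 0 <= e ->
  (1 - r) ^+ 2 * ((1 + r / 2) * q + (1 + (r / 2)^-1) * e)
    <= (1 - r / 2) * q + 2 / r * e.
Proof.
move=> r0 r1 q0 e0; rewrite mulrDr; apply: lerD.
  by rewrite mulrA ler_wpM2r//; nra.
rewrite mulrA ler_wpM2r//.
have -> : (1 - r) ^+ 2 * (1 + (r / 2)^-1) = ((1 - r) ^+ 2 * (r + 2)) / r.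
  by field; rewrite gt_eqF.
by rewrite ler_wpM2r ?invr_ge0 ?ltW//; nra.
Qed.

(** The momentum average forgets its error at rate rho and is perturbed by the
    displacement of the gradient, at most L c D for a step of size c. *)
Lemma momentum_drift (x y g : 'rV[R]_n) (r c : R) :
  C x -> C y -> 0 < r -> r <= 1 -> enorm (y - x) <= c * D ->
  enorm ((1 - r) *: (gradient F y - g)) ^+ 2
    <= (1 - r / 2) * enorm (gradient F x - g) ^+ 2 + 2 / r * (L * (c * D)) ^+ 2.
Proof.
move=> Cx Cy r0 r1 xy.
have -> : gradient F y - g = (gradient F x - g) + (gradient F y - gradient F x).
  by rewrite [RHS]addrC addrA subrK.
rewrite enormZ exprMn real_normK ?num_real//.
have r20 : 0 < r / 2 by lra.
apply: le_trans (ler_wpM2l (sqr_ge0 _) (enorm_sqrD_le _ _ r20)) _.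
have LD : enorm (gradient F y - gradient F x) ^+ 2 <= (L * (c * D)) ^+ 2.
  rewrite ler_sqr ?nnegrE ?enorm_ge0//.
    exact: le_trans (F_smooth Cy Cx) (ler_wpM2l L0 xy).
  exact: mulr_ge0 L0 (le_trans (enorm_ge0 _) xy).
apply: le_trans (momentum_coef r0 r1 (sqr_ge0 _) (sqr_ge0 _)) _.
by rewrite lerD2l ler_wpM2l// divr_ge0// ltW.
Qed.

(** The linear minimization oracle is called with g in place of the gradient; the
    price is the error of g times the diameter. *)
Lemma frank_wolfe_step (x v g xstar : 'rV[R]_n) (c : R) :
  C x -> argmin C F xstar -> argmin C (dotr g) v -> 0 <= c -> c <= 1 ->
  F ((1 - c) *: x + c *: v) - F xstar <=
    (1 - c) * (F x - F xstar) + c * (D * enorm (gradient F x - g))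
    + L * D ^+ 2 / 2 * c ^+ 2.
Proof.
move=> Cx [Cs _] [Cv vmin] c0 c1.
set y := (1 - c) *: x + c *: v.
have Cy : C y by exact: convex_set_segment.
have yx : y - x = c *: (v - x).
  by apply/rowP => i; rewrite !mxE; ring.
have := descent_lemma C_convex F_differentiable F_smooth Cx Cy.
rewrite yx dotrZr enormZ ger0_norm// exprMn => H.
have vx : enorm (v - x) ^+ 2 <= D ^+ 2.
  rewrite ler_sqr ?nnegrE ?enorm_ge0 ?diam_C//.
  exact: le_trans (enorm_ge0 _) (diam_C Cv Cx).
have H1 := convex_first_order C_convex F_convex Cx Cs (F_differentiable Cx).
have H2 := vmin _ Cs.
have H3 := cauchy_schwarz (gradient F x - g) (v - xstar).
have H4 : enorm (gradient F x - g) * enorm (v - xstar)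
    <= D * enorm (gradient F x - g).
  by rewrite mulrC ler_wpM2r ?enorm_ge0 ?diam_C.
have H5 : dotr (gradient F x) (v - x) <=
    F xstar - F x + D * enorm (gradient F x - g).
  move: H1 H2 H3 H4; rewrite !(dotrBl, dotrBr); lra.
have H6 : L / 2 * (c ^+ 2 * enorm (v - x) ^+ 2) <= L / 2 * (c ^+ 2 * D ^+ 2).
  by rewrite ler_wpM2l ?divr_ge0// ler_wpM2l ?sqr_ge0.
have H7 : c * dotr (gradient F x) (v - x) <=
    c * (F xstar - F x + D * enorm (gradient F x - g)) by rewrite ler_wpM2l.
lra.
Qed.

End Geometry.

(** Bounding e linearly in e^2 pointwise passes from a second moment to a first
    moment without square roots of integrals. *)
Lemma amgm_weighted (R : realType) (k e : R) : 0 < k -> e <= (k + e ^+ 2 / k) / 2.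
Proof.
move=> k0; rewrite ler_pdivlMr// -(ler_pM2r k0) mulrDl divfK ?gt_eqF//.
have := sqr_ge0 (e - k); nra.
Qed.

(** The best weight is k = m; for m = 0 it is only approached, by letting k tend
    to 0. *)
Lemma optimize_weight (R : realType) (X : \bar R) (a b m : R) :
  0 <= b -> 0 <= m ->
  (forall k, 0 < k -> (X <= (a + b * (k + 2 * m ^+ 2 / k))%:E)%E) ->
  (X <= (a + b * (3 * m))%:E)%E.
Proof.
move=> b0; rewrite le_eqVlt => /predU1P[<- H|m0 H].
  apply/lee_addgt0Pr => e e0.
  have b1 : 0 < b + 1 by rewrite ltr_wpDl.
  apply: le_trans (H _ (divr_gt0 e0 b1)) _.
  rewrite -EFinD lee_fin expr0n /= !mulr0 mul0r !addr0 lerD2l mulrC mulrAC.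
  by rewrite ler_pdivrMr// ler_pM2l// lerDl.
apply: le_trans (H _ m0) _; rewrite lee_fin lerD2l ler_wpM2l//.
by rewrite le_eqVlt; apply/orP; left; apply/eqP; field; rewrite gt_eqF.
Qed.

(** * The two expected recursions along a run *)

Section Run.
Context (R : realType) (n : nat) (dZ dO : measure_display)
  (Z : measurableType dZ) (Omega : measurableType dO).
Variables (P : probability Z R) (Pr : probability Omega R) (C : set 'rV[R]_n).
Variables (Ft : 'rV[R]_n -> Z -> R) (F : 'rV[R]_n -> R) (D L sigma : R).
Hypotheses (C_convex : convex_set C)
  (Ft_measurable :
      measurable_fun setT (fun p : (borel_rV R n * Z)%type => Ft p.1 p.2))
  (F_def : forall x, (F x)%:E = ('E_P[Ft x])%E)
  (Ft_differentiable : forall x z, C x ->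
      differentiable ((fun y => Ft y z) : 'rV[R]_n -> R^o) x)
  (F_differentiable : forall x, C x ->
      differentiable (F : 'rV[R]_n -> R^o) x)
  (diam_C : forall x y, C x -> C y -> enorm (x - y) <= D)
  (F_convex : convex_function C F)
  (F_smooth : forall x y, C x -> C y ->
      enorm (gradient F x - gradient F y) <= L * enorm (x - y))
  (Ft_unbiased : forall x, C x -> forall i : 'I_n,
      ('E_P[fun z => gradient (fun y => Ft y z) x ord0 i])%E =
      (gradient F x ord0 i)%:E)
  (Ft_variance : forall x, C x ->
      ('E_P[fun z => (enorm (gradient (fun y => Ft y z) x - gradient F x) ^+ 2)%R]
       <= ((sigma ^+ 2)%R)%:E)%E)
  (L0 : 0 <= L).
Variables (xstar : 'rV[R]_n) (X : nat -> {RV Pr >-> Z}) (rho gamma : nat -> R).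
Variables (x0 d0 : 'rV[R]_n) (x dir v : nat -> Omega -> 'rV[R]_n).
Hypotheses (xstar_min : argmin C F xstar) (X_iid : iid_samples P X) (x0C : C x0)
  (run : SFW_run C Ft X rho gamma x0 d0 x dir v)
  (rho_gt0 : forall t, 0 < rho t.+1) (rho_le1 : forall t, rho t.+1 <= 1)
  (gamma_ge0 : forall t, 0 <= gamma t.+1) (gamma_le1 : forall t, gamma t.+1 <= 1).

Lemma oracle_in t w : C (v t w).
Proof. by have [] := SFW_v run t w. Qed.

Lemma iterate_in t w : C (x t w).
Proof.
elim: t => [|t IH]; first by rewrite (SFW_x0 run).
by rewrite (SFW_xS run); apply: convex_set_segment => //; exact: oracle_in.
Qed.

Lemma iterate_dist t w : enorm (x t.+1 w - x t w) <= gamma t.+1 * D.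
Proof.
have -> : x t.+1 w - x t w = gamma t.+1 *: (v t w - x t w).
  by rewrite (SFW_xS run); apply/rowP => i; rewrite !mxE; ring.
rewrite enormZ ger0_norm// ler_wpM2l//; apply: diam_C; last exact: iterate_in.
exact: oracle_in.
Qed.

Lemma measurable_oracle t : measurable_fun setT (v t : past X t -> borel_rV R n).
Proof. by move=> _ B mB; rewrite setTI; exact: (SFW_v_adapted run). Qed.

(** Iterate t+1 is decided before sample t+1 is drawn. *)
Lemma measurable_iterate t :
  measurable_fun setT (x t.+1 : past X t -> borel_rV R n).
Proof.
elim: t => [|t IH].
  have -> : x 1%N = (fun w => (1 - gamma 1%N) *: x0 + gamma 1%N *: v 0%N w).
    by apply/funext => w; rewrite (SFW_xS run) (SFW_x0 run).
  apply: (@measurable_linear_comb _ _ _ (past X 0) _ _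
    (cst (x0 : borel_rV R n)) (v 0%N)) => //.
  exact: measurable_oracle.
have -> : x t.+2 = (fun w =>
    (1 - gamma t.+2) *: x t.+1 w + gamma t.+2 *: v t.+1 w).
  by apply/funext => w; rewrite (SFW_xS run).
apply: (@measurable_linear_comb _ _ _ (past X t.+1) _ _
    (x t.+1 : past X t.+1 -> borel_rV R n) (v t.+1)); last exact: measurable_oracle.
exact: measurable_fun_past_mono IH.
Qed.

Let fullgrad t (w : Omega) := gradient F (x t w).
Let noisygrad t (p : Omega * Z) := gradient (fun y => Ft y p.2) (x t p.1).

Lemma measurable_fullgrad t :
  measurable_fun setT (fullgrad t.+1 : past X t -> borel_rV R n).
Proof.
apply: (@measurable_gradient _ _ _ (past X t) _ (past X t)
  (fun y _ => F y) (x t.+1) id) => //.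
- apply: (measurableT_comp (measurable_objective Ft_measurable F_def)).
  exact: measurable_fst.
- exact: measurable_iterate.
- by move=> w; apply: F_differentiable; exact: iterate_in.
Qed.

Lemma measurable_noisygrad t :
  measurable_fun setT (noisygrad t.+1 : (past X t * Z)%type -> borel_rV R n).
Proof.
apply: (@measurable_gradient _ _ _ (past X t * Z)%type _ Z Ft
  (fun p => x t.+1 p.1) snd) => //.
- exact: (measurableT_comp (@measurable_iterate t)
    (measurable_fst : measurable_fun setT (fst : past X t * Z -> past X t))).
- by move=> p; apply: Ft_differentiable; exact: iterate_in.
Qed.

(** The run stays adapted because the noisy gradient is jointly measurable in the
    past and in the new sample. *)
Lemma measurable_momentum t :
  measurable_fun setT (dir t : past X t -> borel_rV R n).
Proof.
elim: t => [|t IH].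
  have -> : dir 0%N = cst d0 by apply/funext => w; rewrite (SFW_d0 run).
  exact: measurable_cst.
have -> : dir t.+1 = (fun w => (1 - rho t.+1) *: dir t w
    + rho t.+1 *: noisygrad t.+1 (w, X t.+1 w)).
  by apply/funext => w; rewrite (SFW_dS run).
apply: (@measurable_linear_comb _ _ _ (past X t.+1) _ _
  (dir t : past X t.+1 -> borel_rV R n)
  (fun w => noisygrad t.+1 (w, X t.+1 w))).
  exact: measurable_fun_past_mono IH.
apply: (measurableT_comp (@measurable_noisygrad t)
  (g := fun w : past X t.+1 => (w, X t.+1 w) : (past X t * Z)%type)).
have mid := @measurable_fun_past_mono _ _ _ _ _ _ X t t.+1 _ (past X t) id
  (leqnSn t) (@measurable_id _ _ setT).
have mX : measurable_fun setT (X t.+1 : past X t.+1 -> Z).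
  by move=> mT B mB; apply: (@sample_past _ _ _ _ _ _ X t.+1); rewrite ?ltnSn.
exact: measurable_fun_pair mid mX.
Qed.

Let err t (w : Omega) : R := enorm (fullgrad t w - dir t w) ^+ 2.

Let err_ge0 t w : 0 <= err t w. Proof. exact: sqr_ge0. Qed.

Lemma measurable_error t : measurable_fun [set: Omega] (err t).
Proof.
have mdir : measurable_fun setT (dir t : Omega -> borel_rV R n).
  exact: (@measurable_fun_past _ _ _ _ _ _ X t _ _ _ (@measurable_momentum t)).
have mg : measurable_fun setT (fullgrad t : Omega -> borel_rV R n).
  case: t {mdir} => [|t].
    rewrite (_ : fullgrad 0%N = cst (gradient F x0)) ?measurable_cst//.
    by apply/funext => w; rewrite /fullgrad (SFW_x0 run).
  exact: (@measurable_fun_past _ _ _ _ _ _ X t _ _ _ (@measurable_fullgrad t)).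
exact: measurable_sqdist mg mdir.
Qed.

(** Freezing the past turns the conditional expectation over the fresh sample
    into an integral over P, where unbiasedness applies. *)
Lemma expected_error_step t (b : R) :
  (\int[Pr]_w (err t w)%:E <= b%:E)%E ->
  (\int[Pr]_w (err t.+1 w)%:E <=
     ((1 - rho t.+1 / 2) * b + (rho t.+1 ^+ 2 * sigma ^+ 2
        + 2 / rho t.+1 * (L * (gamma t.+1 * D)) ^+ 2))%:E)%E.
Proof.
move=> errb.
pose r := rho t.+1.
pose f (p : past X t * Z) : \bar R :=
  (enorm (fullgrad t.+1 p.1
     - ((1 - r) *: dir t p.1 + r *: noisygrad t.+1 p)) ^+ 2)%:E.
have f0 p : (0 <= f p)%E by rewrite lee_fin sqr_ge0.
have mf : measurable_fun setT f.
  have mfst := measurable_fst : measurable_fun setT (fst : past X t * Z -> past X t).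
  have mc := measurable_linear_comb (1 - r) r
    (measurableT_comp (@measurable_momentum t) mfst) (@measurable_noisygrad t).
  have mg := measurableT_comp (@measurable_fullgrad t) mfst.
  by apply/measurable_EFinP; exact: measurable_sqdist mg mc.
have -> : (\int[Pr]_w (err t.+1 w)%:E = \int[Pr]_w f (w, X t.+1 w))%E.
  by apply: eq_integral => w _; rewrite /err /f /= (SFW_dS run).
rewrite (ge0_integral_next_sample X_iid)//.
have inner_ge0 w : (0 <= \int[P]_z f (w, z))%E by exact: integral_ge0.
have minner : measurable_fun [set: Omega] (fun w => \int[P]_z f (w, z))%E.
  have h := @measurable_fun_fubini_tonelli_F _ _ _ _ _ P _ mf f0.
  exact: (@measurable_fun_past _ _ _ _ _ _ X t _ _ _ h).
have r0 : 0 < r by exact: rho_gt0.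
have K0 : 0 <= r ^+ 2 * sigma ^+ 2 + 2 / r * (L * (gamma t.+1 * D)) ^+ 2.
  by apply: addr_ge0; apply: mulr_ge0; rewrite ?sqr_ge0 ?divr_ge0 ?(ltW r0).
have r2 : 0 <= 1 - r / 2 by have := rho_le1 t; rewrite -/r; lra.
have int0 : (\int[Pr]_(w in [set: Omega]) (0 : R)%:E <= 0%:E)%E by rewrite integral0.
have := @integral_le_affine _ _ _ Pr _ (err t) (fun=> 0) (1 - r / 2) 0 _ b 0
  minner (@measurable_error t) (measurable_cst _) inner_ge0 (err_ge0 t)
  (fun=> lexx 0) r2 (lexx 0) K0 _ errb int0.
rewrite mul0r !addr0; apply => w; rewrite ?mul0r ?addr0.
have Cx := iterate_in t.+1 w.
set g := fullgrad t.+1 w.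
have fE z : f (w, z) = (enorm ((1 - r) *: (g - dir t w)
    - r *: (noisygrad t.+1 (w, z) - g)) ^+ 2)%:E.
  rewrite /f /= -/g; congr ((enorm _ ^+ 2)%:E).
  by apply/rowP => i; rewrite !mxE; ring.
under eq_integral do rewrite fE.
apply: le_trans (sqnorm_unbiased_le _ r _ (Ft_unbiased Cx) (Ft_variance Cx)) _.
  apply: (@measurable_gradient _ _ _ Z _ Z Ft (cst (x t.+1 w : borel_rV R n)) id) => //.
  by move=> z; exact: Ft_differentiable.
rewrite lee_fin addrA addrAC lerD2r.
exact: (momentum_drift F_smooth L0 (dir t w) (iterate_in t w) Cx (rho_gt0 t)
  (rho_le1 t) (iterate_dist t w)).
Qed.

Let gap t (w : Omega) : R := F (x t w) - F xstar.

Let gap_ge0 t w : 0 <= gap t w.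
Proof. by rewrite subr_ge0; apply: xstar_min.2; exact: iterate_in. Qed.

Lemma measurable_gap t : measurable_fun [set: Omega] (gap t).
Proof.
apply: measurable_funB; last exact: measurable_cst.
have mF := measurable_objective Ft_measurable F_def.
case: t => [|t].
  rewrite (_ : (fun w => F (x 0%N w)) = cst (F x0)) ?measurable_cst//.
  by apply/funext => w; rewrite (SFW_x0 run).
apply: (measurableT_comp mF).
exact: (@measurable_fun_past _ _ _ _ _ _ X t _ _ _ (@measurable_iterate t)).
Qed.

(** The sure one-step inequality is linear in the first moment of the error;
    the weight k trades it for the second moment and is optimized last. *)
Lemma expected_gap_step t (a m : R) : 0 <= m ->
  (\int[Pr]_w (gap t w)%:E <= a%:E)%E ->
  (\int[Pr]_w (err t w)%:E <= (2 * m ^+ 2)%:E)%E ->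
  (\int[Pr]_w (gap t.+1 w)%:E <=
     ((1 - gamma t.+1) * a + gamma t.+1 * (D * (3 / 2 * m))
        + L * D ^+ 2 / 2 * gamma t.+1 ^+ 2)%:E)%E.
Proof.
move=> m0 gapa errm; set c := gamma t.+1.
have D0 : 0 <= D by apply: le_trans (diam_C x0C x0C); exact: enorm_ge0.
have c0 : 0 <= c by exact: gamma_ge0.
have -> : (1 - c) * a + c * (D * (3 / 2 * m)) + L * D ^+ 2 / 2 * c ^+ 2
   = ((1 - c) * a + L * D ^+ 2 / 2 * c ^+ 2) + c * D / 2 * (3 * m) by field.
apply: optimize_weight => //; first by rewrite divr_ge0// mulr_ge0.
move=> k k0.
have K0 : 0 <= L * D ^+ 2 / 2 * c ^+ 2 + c * D / 2 * k.
  by rewrite addr_ge0// ?mulr_ge0 ?sqr_ge0 ?invr_ge0// ltW.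
have b0 : 0 <= c * D / 2 / k by rewrite divr_ge0 ?(ltW k0)// divr_ge0// mulr_ge0.
have c1 : 0 <= 1 - c by rewrite subr_ge0; exact: gamma_le1.
have mgap : measurable_fun [set: Omega] (EFin \o gap t.+1).
  exact/measurable_EFinP/measurable_gap.
have := @integral_le_affine _ _ _ Pr _ _ _ _ _ _ _ _ mgap (@measurable_gap t)
  (@measurable_error t) (fun w => gap_ge0 t.+1 w) (gap_ge0 t) (err_ge0 t)
  c1 b0 K0 _ gapa errm.
rewrite (_ : (1 - c) * a + c * D / 2 / k * (2 * m ^+ 2)
    + (L * D ^+ 2 / 2 * c ^+ 2 + c * D / 2 * k)
  = (1 - c) * a + L * D ^+ 2 / 2 * c ^+ 2 + c * D / 2 * (k + 2 * m ^+ 2 / k));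
  last by field; rewrite gt_eqF.
apply => w; rewrite lee_fin /gap (SFW_xS run) -/c.
apply: le_trans (frank_wolfe_step C_convex F_convex F_differentiable diam_C F_smooth
  L0 (iterate_in t w) xstar_min (SFW_v run t w) c0 (gamma_le1 t)) _.
have := ler_wpM2l (mulr_ge0 c0 D0) (amgm_weighted (enorm (gradient F (x t w) - dir t w)) k0).
rewrite -/(fullgrad t w) -/(err t w) -!/(gap t w).
have -> : c * D * ((k + err t w / k) / 2) = c * D / 2 * k + c * D / 2 / k * err t w.
  by field; rewrite gt_eqF.
rewrite mulrA; lra.
Qed.

End Run.

(** * The convergence rate *)

Theorem theorem3 (R : realType) (n : nat)
    (dZ dO : measure_display) (Z : measurableType dZ) (Omega : measurableType dO)
    (P : probability Z R) (Pr : probability Omega R)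
    (C : set 'rV[R]_n)
    (C_nonempty : C !=set0) (C_compact : compact C) (C_convex : convex_set C)
    (Ft : 'rV[R]_n -> Z -> R) (F : 'rV[R]_n -> R)
    (Ft_measurable :
      measurable_fun setT (fun p : (borel_rV R n * Z)%type => Ft p.1 p.2))
    (Ft_integrable : forall x, P.-integrable setT (fun z => (Ft x z)%:E))
    (F_def : forall x, (F x)%:E = ('E_P[Ft x])%E)
    (Ft_differentiable : forall x z, C x ->
      differentiable ((fun y => Ft y z) : 'rV[R]_n -> R^o) x)
    (F_differentiable : forall x, C x ->
      differentiable (F : 'rV[R]_n -> R^o) x)
    (D L sigma : R)
    (diam_C : forall x y, C x -> C y -> enorm (x - y) <= D)
    (F_convex : convex_function C F)
    (F_smooth : forall x y, C x -> C y ->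
      enorm (gradient F x - gradient F y) <= L * enorm (x - y))
    (Ft_unbiased : forall x, C x -> forall i : 'I_n,
      ('E_P[fun z => gradient (fun y => Ft y z) x ord0 i])%E =
      (gradient F x ord0 i)%:E)
    (Ft_variance : forall x, C x ->
      ('E_P[fun z => (enorm (gradient (fun y => Ft y z) x - gradient F x) ^+ 2)%R]
       <= ((sigma ^+ 2)%R)%:E)%E)
    (xstar : 'rV[R]_n) (xstar_min : argmin C F xstar)
    (X : nat -> {RV Pr >-> Z}) (X_iid : iid_samples P X)
    (rho gamma : nat -> R)
    (gammaE : forall t, gamma t = 2 / (t%:R + 8))
    (rhoE : forall t, rho t = 4 / (t%:R + 8) `^ (2 / 3))
    (x0 : 'rV[R]_n) (x0C : C x0) (d0 : 'rV[R]_n) (d0E : d0 = 0)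
    (x dir v : nat -> Omega -> 'rV[R]_n)
    (run : SFW_run C Ft X rho gamma x0 d0 x dir v) :
  let Q := Num.max
    (9 `^ (1 / 3) * (F x0 - F xstar))
    (L * D ^+ 2 / 2
     + 2 * D * Num.max (2 * enorm (gradient F x0 - d0))
                       ((16 * sigma ^+ 2 + 2 * L ^+ 2 * D ^+ 2) `^ (1 / 2))) in
  forall t : nat,
    ('E_Pr[fun w => (F (x t w) - F xstar)%R]
     <= ((Q / (t%:R + 9) `^ (1 / 3))%R)%:E)%E.
Proof.
move=> Q t.
pose c (t : nat) : R := (t%:R + 9) `^ (1 / 3).
have s0 (u : nat) : 0 <= u%:R + 9 :> R by rewrite addr_ge0.
have cX3 u : c u ^+ 3 = u%:R + 9 by exact: cbrtX3.
have cS u : c u.+1 ^+ 3 = c u ^+ 3 + 1 by rewrite !cX3 -natr1; ring.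
have c_ge0 u : 0 <= c u by exact: powR_ge0.
have c2 u : 2 <= c u.
  rewrite -ler_cube// cX3; have := ler0n R u; lra.
have c_gt0 u : 0 < c u by apply: lt_le_trans (c2 u).
have shift u : u.+1%:R + 8 = u%:R + 9 :> R by rewrite -natr1; ring.
have gE u : gamma u.+1 = 2 / c u ^+ 3 by rewrite gammaE shift cX3.
have rE u : rho u.+1 = 4 / c u ^+ 2 by rewrite rhoE shift powR23.
have c24 u : 4 <= c u ^+ 2 by have := c2 u; nra.
have c38 u : 8 <= c u ^+ 3 by rewrite cX3; have := ler0n R u; lra.
have c2_gt0 u : 0 < c u ^+ 2 by rewrite exprn_gt0.
have c3_gt0 u : 0 < c u ^+ 3 by rewrite exprn_gt0.
have rho_gt0 u : 0 < rho u.+1 by rewrite rE divr_gt0.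
have rho_le1 u : rho u.+1 <= 1 by rewrite rE ler_pdivrMr// mul1r.
have gamma_ge0 u : 0 <= gamma u.+1 by rewrite gE divr_ge0// ltW.
have gamma_le1 u : gamma u.+1 <= 1.
  by rewrite gE ler_pdivrMr// mul1r; have := c38 u; lra.
have xC u w : C (x u w) := iterate_in C_convex x0C run gamma_ge0 gamma_le1 u w.
have gap0 : 0 <= F x0 - F xstar by rewrite subr_ge0; exact: xstar_min.2.
have Q0 : 0 <= Q by rewrite /Q le_max mulr_ge0 ?powR_ge0.
rewrite unlock -/(c t).
have [L0|Lneg] := leP 0 L; last first.
  (* a negative Lipschitz constant forces C to be a single point *)
  have C1 y : C y -> y = xstar.
    move=> Cy; apply/eqP; rewrite -subr_eq0; apply/eqP; apply: enorm0_eq0.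
    apply/eqP; rewrite eq_le enorm_ge0 andbT -(nmulr_rge0 _ Lneg).
    exact: le_trans (enorm_ge0 _) (F_smooth _ _ Cy xstar_min.1).
  under eq_integral do rewrite (C1 _ (xC _ _)) subrr.
  by rewrite integral0 lee_fin divr_ge0.
have D0 : 0 <= D by apply: le_trans (diam_C _ _ x0C x0C); exact: enorm_ge0.
pose K := 16 * sigma ^+ 2 + 2 * L ^+ 2 * D ^+ 2.
have K0 : 0 <= K by rewrite /K; have := sqr_ge0 sigma; have := sqr_ge0 (L * D); nra.
pose M := Num.max (2 * enorm (gradient F x0 - d0)) (K `^ (1 / 2)).
have M0 : 0 <= M by rewrite /M le_max mulr_ge0 ?enorm_ge0.
have MK : K <= 2 * M ^+ 2.
  have : K <= M ^+ 2.
    have -> : K = (K `^ (1 / 2)) ^+ 2 by rewrite div1r powR12_sqrt ?sqr_sqrtr.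
    by rewrite ler_sqr ?nnegrE ?powR_ge0// /M le_max lexx orbT.
  by have := sqr_ge0 M; lra.
have Merr : enorm (gradient F x0 - d0) ^+ 2 <= 2 * M ^+ 2 / c 0%N ^+ 2.
  have e0 := enorm_ge0 (gradient F x0 - d0).
  have : 2 * enorm (gradient F x0 - d0) <= M by rewrite /M le_max lexx.
  have : c 0%N <= 5 / 2 by rewrite -ler_cube ?divr_ge0// cX3; lra.
  have := c_gt0 0%N => c0 c52 eM.
  rewrite ler_pdivlMr//.
  have c8 : c 0%N ^+ 2 <= 8 by nra.
  have eM2 : 4 * enorm (gradient F x0 - d0) ^+ 2 <= M ^+ 2 by nra.
  have := sqr_ge0 (enorm (gradient F x0 - d0)); nra.
(* The factor 2 is what makes the bound hold at u = 0, where c^2 = 9^(2/3) > 4. *)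
have err_bound u : (\int[Pr]_w
    (enorm (gradient F (x u w) - dir u w) ^+ 2)%:E <= (2 * M ^+ 2 / c u ^+ 2)%:E)%E.
  elim: u => [|u IH].
    under eq_integral do rewrite (SFW_x0 run) (SFW_d0 run).
    by rewrite integral_cst//= probability_setT mule1 lee_fin.
  apply: le_trans (expected_error_step C_convex Ft_measurable F_def
    Ft_differentiable F_differentiable diam_C F_smooth Ft_unbiased Ft_variance
    L0 X_iid x0C run rho_gt0 rho_le1 gamma_ge0 gamma_le1 IH) _.
  rewrite lee_fin.
  apply: le_trans (momentum_step (c2 u) (c_gt0 u.+1) (cS u) _ MK); last first.
    by rewrite mulr_ge0 ?sqr_ge0.
  rewrite rE gE lerD2l le_eqVlt; apply/orP; left; apply/eqP; rewrite /K.
  by field; rewrite gt_eqF.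
elim: t => [|t IH].
  under eq_integral do rewrite (SFW_x0 run).
  rewrite integral_cst//= probability_setT mule1 lee_fin ler_pdivlMr//.
  by rewrite /Q le_max; apply/orP; left; rewrite mulrC /c add0r.
have errm : (\int[Pr]_w (enorm (gradient F (x t w) - dir t w) ^+ 2)%:E
    <= (2 * (M / c t) ^+ 2)%:E)%E.
  by apply: le_trans (err_bound t) _; rewrite lee_fin expr_div_n [leRHS]mulrA.
have Mc0 : 0 <= M / c t by rewrite divr_ge0.
apply: le_trans (expected_gap_step C_convex Ft_measurable F_def
    Ft_differentiable F_differentiable diam_C F_convex F_smooth
    L0 xstar_min x0C run gamma_ge0 gamma_le1 Mc0 IH errm) _.
rewrite lee_fin.
have DM0 : 0 <= D * M by rewrite mulr_ge0.
have LD0 : 0 <= L * D ^+ 2 / 2 by rewrite divr_ge0// mulr_ge0// sqr_ge0.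
have KQ : L * D ^+ 2 / 2 + 2 * (D * M) <= Q.
  by rewrite /Q -/K -/M le_max mulrA lexx orbT.
apply: le_trans (gap_step (c2 t) (c_gt0 t.+1) (cS t) DM0 LD0 KQ).
rewrite gE le_eqVlt; apply/orP; left; apply/eqP.
by field; rewrite gt_eqF.
Qed.
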